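(* For every integer $n \ge 3$, the cycle $C_n$ satisfies $$\mu(S(C_n)) = \begin{cases} 6, & \text{if } n = 4,\\ n+1, & \text{if } n \in \{3,5,6\},\\ n, & \text{if } n \ge 7.\end{cases}$$
   Context: The shadow graph $S(G)$ of a graph $G$ is obtained from $G$ by adding, for each vertex $v$ of $G$, a new vertex $v'$ (the shadow vertex of $v$), and joining $v'$ to all neighbours of $v$ in $G$ (shadow vertices are pairwise non-adjacent). For a vertex set $X$ of a graph $H$, two vertices $u,v$ are $X$-visible if there is a shortest $u,v$-path $P$ in $H$ with $V(P)\cap X \subseteq \{u,v\}$. The set $X$ is a mutual-visibility set if every two vertices of $X$ are $X$-visible; $\mu(H)$ is the maximum cardinality of a mutual-visibility set of $H$. *)

(* Defs.v *)
From mathcomp Require Import all_boot.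
From mathcomp Require Import boolp.

Set Implicit Arguments.
Unset Strict Implicit.
Unset Printing Implicit Defensive.

(* A simple graph is given by its adjacency relation, a symmetric and
   irreflexive [rel] on the finite type of its vertices. *)

Section MutualVisibility.
Variables (T : finType) (e : rel T).

(* [p] omits the initial vertex [u]: the vertex sequence of the path is
   [u :: p] and its length is [size p]. *)
Definition is_upath (u v : T) (p : seq T) : bool :=
  [&& path e u p, last u p == v & uniq (u :: p)].

Definition shortest_path (u v : T) (p : seq T) : Prop :=
  is_upath u v p /\ forall q : seq T, is_upath u v q -> size p <= size q.

Definition visible (X : {set T}) (u v : T) : Prop :=
  exists2 p : seq T, shortest_path u v p
    & [set x in u :: p] :&: X \subset [set u; v].

Definition mutual_visibility_set (X : {set T}) : Prop :=
  {in X &, forall u v, u != v -> visible X u v}.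

Definition mu : nat :=
  \max_(X : {set T} | `[< mutual_visibility_set X >]) #|X|.

(* [inl v] is the original vertex [v] and [inr v] is its shadow [v']. *)
Definition shadow : rel (T + T)%type := fun x y =>
  match x, y with
  | inl u, inl v => e u v
  | inl u, inr v => e v u
  | inr u, inl v => e u v
  | inr _, inr _ => false
  end.

Lemma shadow_sym : symmetric e -> symmetric shadow.
Proof. by move=> es [u|u] [v|v] //=; rewrite es. Qed.

Lemma shadow_irr : irreflexive e -> irreflexive shadow.
Proof. by move=> ei [u|u] //=; rewrite ei. Qed.

End MutualVisibility.

(* [ordS i] is [i + 1] modulo [n]; this is the cycle C_n when [3 <= n]. *)
Definition cycle_graph (n : nat) : rel 'I_n :=
  fun i j => (ordS i == j) || (ordS j == i).

Lemma cycle_graph_sym n : symmetric (@cycle_graph n).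
Proof. by move=> i j; rewrite /cycle_graph orbC. Qed.

Lemma cycle_graph_irr n : 2 <= n -> irreflexive (@cycle_graph n).
Proof.
move=> n2 i; rewrite /cycle_graph orbb; apply/negbTE/eqP => /(congr1 val) /=.
have [lt|le] := ltnP i.+1 n; first by rewrite modn_small // => /eqP; rewrite eqn_leq ltnn.
have -> : i.+1 = n by apply/eqP; rewrite eqn_leq le ltn_ord.
by rewrite modnn => i0; move: le n2; rewrite -i0 leqNgt => /negP.
Qed.

(* Main.v *)
Require Import Defs.
From mathcomp Require Import all_boot.
From mathcomp Require Import boolp zify.

(** The set of all shadow vertices is mutually visible: in a shortest path
between two shadows, the interior vertices can be replaced by their originals.
Hence [n <= mu].

For [n >= 7], call the pair formed by a vertex and its shadow a column, of
weight its number of vertices in [X].  A column of weight 2 cannot be crossed,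
so it cannot lie between two nonempty columns at distance less than [n / 2]
from each other.  If the weights sum to more than [n], there are more columns of
weight 2 than empty ones, so some column [k] of weight 2 is followed by a
nonempty one.  The columns before [k], up to nearly half of the cycle, are then
empty, and at most four columns can have weight 2; this is a contradiction as
soon as [n >= 11].  The remaining weight patterns ([7 <= n <= 10]) and the
graphs with [n <= 6] are finitely many and are checked by computation. *)

Set Implicit Arguments.
Unset Strict Implicit.
Unset Printing Implicit Defensive.

(* [has] itself evaluates both arguments of [||] under [vm_compute]. *)
Fixpoint lazy_has T (p : pred T) (s : seq T) : bool :=
  if s is x :: s' then if p x then true else lazy_has p s' else false.

Lemma lazy_hasE T (p : pred T) s : lazy_has p s = has p s.
Proof. by elim: s => //= x s ->; case: (p x). Qed.

(** * Exhaustive search over words *)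

Section Words.
Variables (T : eqType) (A : seq T).

(** The prefix chosen so far is absorbed into [test], so the list of all words is never built. *)
Fixpoint all_words k (test : seq T -> bool) : bool :=
  if k is k'.+1 then all (fun a => all_words k' (fun w => test (a :: w))) A
  else test [::].

Lemma all_wordsP k test : all_words k test ->
  forall w, size w = k -> {subset w <= A} -> test w.
Proof.
elim: k test => [|k IHk] test /=; first by move=> ? [].
move=> /allP tA [|a w] //= [sz_w] sub.
have aA : a \in A by apply: sub; rewrite mem_head.
apply: (IHk _ (tA a aA) w sz_w) => x xw.
by apply: sub; rewrite in_cons xw orbT.
Qed.

End Words.

(** * Periodic weight sequences *)

Section PeriodicWeights.
Variables (n : nat) (W : nat -> nat).
Hypothesis W_periodic : forall m, W (m + n) = W m.

(** Moving the window by one drops [f (W k)] and gains [f (W (k + n))], equal to it by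
    periodicity. *)
Lemma periodic_sum_shift (f : nat -> nat) k :
  \sum_(t < n) f (W (k + t)) = \sum_(t < n) f (W t).
Proof.
elim: k => // k <-.
rewrite -(big_mkord xpredT (fun t => f (W (k.+1 + t)))).
rewrite -(big_mkord xpredT (fun t => f (W (k + t)))).
case: n W_periodic => [|n'] per; first by rewrite !big_nil.
rewrite big_nat_recr //= big_nat_recl //= addn0 addnC.
congr (f _ + _); first by rewrite addSnnS per.
by apply: eq_bigr => i _; rewrite addSnnS.
Qed.

Hypothesis W_le2 : forall m, W m <= 2.
Hypothesis W_block : forall a b c, a < b < c -> 2 * (c - a) < n ->
  W b = 2 -> W a = 0 \/ W c = 0.

(** Searches for a violation of [W_block]; doubling [s] turns cyclic windows into intervals. *)
Definition blocked_word (s : seq nat) : bool :=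
  let n := size s in
  let ss := s ++ s in
  lazy_has (fun a => if nth 0 ss a is 0 then false else
    lazy_has (fun d => if 2 * d < n then
       if nth 0 ss (a + d) is 0 then false else
       lazy_has (fun b => nth 0 ss (a + b) == 2) (iota 1 d.-1)
       else false) (iota 2 n./2)) (iota 0 n).

Lemma weight_sum_word :
  all_words [:: 0; 1; 2] n
    (fun s => if n < sumn s then blocked_word s else true) ->
  \sum_(i < n) W i <= n.
Proof.
move=> /all_wordsP /(_ (mkseq W n)).
rewrite size_mkseq => /(_ erefl) H; rewrite leqNgt; apply/negP => lt.
have sumE : sumn (mkseq W n) = \sum_(i < n) W i.
  by rewrite sumnE big_map /index_iota -[n in iota 0 n]subn0 big_mkord.
have {H} : blocked_word (mkseq W n).
  move: H; rewrite sumE lt; apply.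
  by move=> x /mapP[m _ ->]; case: (W m) (W_le2 m) => [|[|[|]]].
have nthE m : m < n + n -> nth 0 (mkseq W n ++ mkseq W n) m = W m.
  move=> lt_m; rewrite nth_cat size_mkseq.
  case: ltnP => le_m; first by rewrite nth_mkseq.
  rewrite nth_mkseq; last by lia.
  by rewrite -W_periodic subnK.
rewrite /blocked_word size_mkseq lazy_hasE => /hasP[a].
rewrite mem_iota => /andP[_ lt_a]; rewrite nthE; last by lia.
case Wa: (W a) => [//|wa].
rewrite lazy_hasE => /hasP[d].
rewrite mem_iota; case: ifP => // lt_d /andP[ge_d _].
rewrite nthE; last by lia.
case Wd: (W (a + d)) => [//|wd].
rewrite lazy_hasE => /hasP[b].
rewrite mem_iota => /andP[b1 bd]; rewrite nthE; last by lia.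
move=> /eqP Wb.
by case: (@W_block a (a + b) (a + d)) => //; [lia|lia|rewrite Wa|rewrite Wd].
Qed.

Lemma sum_indicator_count (P : pred nat) m :
  \sum_(t < m) (P t : nat) = size [seq t <- iota 0 m | P t].
Proof.
by rewrite size_filter -sumn_count sumnE big_map -[m in iota 0 m]subn0 big_mkord.
Qed.

Lemma weight_sum_large : 11 <= n -> \sum_(i < n) W i <= n.
Proof.
move=> n11.
(* For [w <= 2], [w + (w == 0) = 1 + (w == 2)]; summing reduces the goal to comparing the numbers of
   twos and zeros. *)
have balance : \sum_(t < n) W t + \sum_(t < n) (W t == 0 : nat) =
               n + \sum_(t < n) (W t == 2 : nat).
  rewrite -[X in _ = X + _]card_ord -sum1_card -!big_split /=; apply: eq_bigr => t _.
  by case: (W t) (W_le2 t) => [|[|[|]]].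
suff le : \sum_(t < n) (W t == 2 : nat) <= \sum_(t < n) (W t == 0 : nat) by lia.
(* If a 0 follows every 2, the shift by one injects the twos into the zeros. *)
have [iso|] := boolP [forall t : 'I_n, (W t == 2) ==> (W (1 + t) == 0)].
  rewrite -(periodic_sum_shift (fun w => w == 0 : nat) 1).
  by apply: leq_sum => t _; move: (forallP iso t); case: (W t == 2) => //= ->.
rewrite negb_forall => /existsP[[k lt_k] /=]; rewrite negb_imply => /andP[/eqP Wk Wk1].
rewrite -(periodic_sum_shift (fun w => w == 0 : nat) k).
rewrite -(periodic_sum_shift (fun w => w == 2 : nat) k).
rewrite (@sum_indicator_count (fun t => W (k + t) == 2)).
rewrite (@sum_indicator_count (fun t => W (k + t) == 0)).
(* The full column [k + n] lies between [k + t] and the nonempty column [k + n + 1], which are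
   [n + 1 - t < n / 2] apart. *)
have empty t : t < n -> n + 2 < 2 * t -> W (k + t) = 0.
  move=> tn ht; case: (@W_block (k + t) (k + n) (k + n + 1)); try lia.
    by rewrite W_periodic.
  by rewrite addnAC W_periodic addn1 => /eqP; rewrite add1n in Wk1; rewrite (negPf Wk1).
(* The last four offsets all exceed [(n + 2) / 2] exactly when [n >= 11]. *)
apply: (@leq_trans 4); last first.
  apply: (@uniq_leq_size _ [:: n - 1; n - 2; n - 3; n - 4]); first by rewrite /= !inE; lia.
  move=> t; rewrite mem_filter mem_iota !inE => ht.
  by rewrite empty ?eqxx; lia.
(* Otherwise [k + s] would separate the nonempty columns [k] and [k + t]. *)
have one s t : 0 < s -> s < t -> 2 * t < n -> W (k + s) = 2 -> W (k + t) = 2 -> False.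
  move=> s0 st tn Ws Wt; case: (@W_block k (k + s) (k + t)); try lia.
pose c := find (fun t => W (k + t) == 2) (iota 1 n).
(* A 2 sits at offset 0, at the first positive offset [c.+1] (the [iota] starts at 1), or at some
   [t] with [n <= 2 * t <= n + 2]. *)
apply: (@uniq_leq_size _ _ [:: 0; c.+1; uphalf n; (uphalf n).+1]).
  exact/filter_uniq/iota_uniq.
move=> t; rewrite mem_filter mem_iota => /andP[/eqP Wt /= tn].
rewrite add0n in tn.
have [le|gt] := leqP (2 * t) (n + 2); last by move: (empty t tn gt); lia.
have [ge|lt] := leqP n (2 * t); first by rewrite !inE; lia.
have [->|t0] := posnP t; first by rewrite inE.
have hc : has (fun t => W (k + t) == 2) (iota 1 n).
  by apply/hasP; exists t; [rewrite mem_iota; lia | apply/eqP].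
move: (nth_find 0 hc); rewrite -/c; move: hc; rewrite has_find -/c size_iota => cn.
rewrite nth_iota // add1n => /eqP Wc.
have ct : c.+1 <= t.
  rewrite leqNgt; apply/negP => tc.
  have := @before_find _ 0 (fun t => W (k + t) == 2) (iota 1 n) t.-1.
  rewrite -/c nth_iota; last by lia.
  rewrite add1n prednK // Wt eqxx => /(_ _); lia.
move: ct; rewrite leq_eqVlt => /orP[/eqP <-|ct]; first by rewrite !inE eqxx !orbT.
by case: (one c.+1 t).
Qed.

Lemma periodic_weight_sum : 7 <= n -> \sum_(i < n) W i <= n.
Proof.
move=> n7; have [|lt] := leqP 11 n; first exact: weight_sum_large.
apply: weight_sum_word.
have : n \in [:: 7; 8; 9; 10] by rewrite !inE; lia.
by rewrite !inE => /or4P[] /eqP ->; vm_compute.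
Qed.

End PeriodicWeights.

(** * Visibility in terms of walks *)

Section Visibility.
Variables (T : finType) (e : rel T).

(* A minimal walk is a path, so visibility can be tested on walks
   [u :: rcons p v], whose interior is [p]. *)
Lemma visibleP (X : {set T}) u v : u != v ->
  visible e X u v <->
  exists p, [/\ path e u (rcons p v), {in p, forall x, x \notin X} &
    forall q, path e u (rcons q v) -> size p <= size q].
Proof.
move=> uv; split.
  case=> p [/and3P[ep /eqP lp up] minp] sub.
  case/lastP: p => [|p w] in ep lp up minp sub *.
    by move: uv; rewrite -lp eqxx.
  rewrite last_rcons in lp; rewrite {w}lp in ep up minp sub *.
  exists p; split=> // [x xp|q eq].
    apply/negP => xX; have: x \in [set u; v].
      apply: (subsetP sub); rewrite inE xX andbT inE in_cons mem_rcons inE xp.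
      by rewrite !orbT.
    move: up; rewrite cons_uniq rcons_uniq mem_rcons inE negb_or.
    case/and3P => /andP[_ up] vp _; rewrite !inE => /orP[] /eqP xE.
      by rewrite -xE xp in up.
    by rewrite -xE xp in vp.
  case/shortenP: eq (last_rcons u q v) => q' eq' uq' sub' lq'.
  rewrite -ltnS -(size_rcons p v) -(size_rcons q v).
  apply: leq_trans (uniq_leq_size (proj2 (andP uq')) sub').
  by apply: minp; rewrite /is_upath eq' lq' eqxx uq'.
case=> p [ep pX minp].
(* Shortening keeps a subset of the vertices and, by minimality, does not lower the length, so no
   vertex was repeated. *)
have up : uniq (u :: rcons p v).
  move: (last_rcons u p v); case/shortenP: (ep) => p' ep' up' sub' lp'.
  suff sz : size (rcons p v) <= size p'.
    apply: (leq_size_uniq up') => // x; rewrite !in_cons.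
    by case: (x == u) => //= /sub'.
  case/lastP: p' => [|p' w] in ep' up' sub' lp' *.
    by move: uv; rewrite -lp' eqxx.
  rewrite last_rcons in lp'; rewrite lp' in ep'.
  by rewrite !size_rcons ltnS; apply: minp.
exists (rcons p v); first split=> [|q /and3P[eq /eqP lq _]].
- by rewrite /is_upath ep last_rcons eqxx up.
- case/lastP: q => [|q w] in eq lq *; first by move: uv; rewrite -lq eqxx.
  rewrite last_rcons in lq; rewrite lq in eq.
  by rewrite !size_rcons ltnS; apply: minp.
apply/subsetP => x; rewrite !inE mem_rcons inE => /andP[/or3P[->|->|xp] xX] //.
  by rewrite orbT.
by rewrite (negPf (pX x xp)) in xX.
Qed.

Lemma shortest_walk_exists u v : u != v -> connect e u v ->
  exists2 p, path e u (rcons p v) &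
    forall q, path e u (rcons q v) -> size p <= size q.
Proof.
move=> uv /connectP[p0 ep0 lp0].
have : exists m, `[< exists2 p, path e u (rcons p v) & size p = m >].
  case/lastP: p0 => [|p w] in ep0 lp0 *; first by move: uv; rewrite lp0 eqxx.
  rewrite last_rcons in lp0; exists (size p); apply/asboolP; exists p => //.
  by rewrite lp0.
case/ex_minnP => m /asboolP[p ep <-] minm; exists p => // q eq.
by apply: minm; apply/asboolP; exists q.
Qed.

Lemma mu_geP (X : {set T}) : mutual_visibility_set e X -> #|X| <= mu e.
Proof.
by move=> visX; apply: leq_bigmax_cond; apply/asboolP.
Qed.

Lemma mu_leP m :
  (forall X : {set T}, mutual_visibility_set e X -> #|X| <= m) -> mu e <= m.
Proof. by move=> H; apply/bigmax_leqP => X /asboolP /H. Qed.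

End Visibility.

(** * Shadow graphs and their projection *)

Section Shadow.
Variables (T : finType) (e : rel T).
Hypothesis e_sym : symmetric e.

Definition base (x : T + T) : T := match x with inl v => v | inr v => v end.

Lemma shadow_base x y : shadow e x y -> e (base x) (base y).
Proof. by case: x y => [x|x] [y|y] //=; rewrite e_sym. Qed.

Lemma shadow_inl_r x v : shadow e x (inl v) = e (base x) v.
Proof. by case: x. Qed.

Lemma shadow_inl_l x v : shadow e (inl v) x = e v (base x).
Proof. by case: x => x //=; rewrite e_sym. Qed.

(** With a nonempty interior, every edge of the lifted walk has an original as an endpoint, so it
    exists as soon as its projection does. *)
Lemma shadow_lift_path u v p : 0 < size p ->
  path e (base u) (rcons (map base p) (base v)) ->
  path (shadow e) u (rcons (map (inl \o base) p) v).
Proof.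
case: p => // x p _ /=; rewrite shadow_inl_r => /andP[-> /=].
elim: p x => [|y p IHp] x /=; first by rewrite -shadow_inl_l.
by case/andP=> -> /IHp.
Qed.

Lemma shadow_project_path u p :
  path (shadow e) u p -> path e (base u) (map base p).
Proof. by elim: p u => //= x p IHp u /andP[/shadow_base -> /IHp]. Qed.

(* Replacing each interior vertex of a walk between two shadows by its original
   keeps the walk a walk, since shadows are pairwise non-adjacent. *)
Lemma shadows_mutually_visible : (forall x y, connect (shadow e) x y) ->
  mutual_visibility_set (shadow e) [set x in codom (@inr T T)].
Proof.
move=> conn _ _ /[!inE] /codomP[x ->] /codomP[y ->] xy.
have [p ep minp] := shortest_walk_exists xy (conn (inr x) (inr y)).
apply/visibleP => //; exists (map (inl \o base) p); split.
- apply: shadow_lift_path; first by case: p ep {minp}.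
  by have := shadow_project_path ep; rewrite map_rcons.
- by move=> _ /mapP[z _ ->]; rewrite inE; apply/codomP => -[].
by move=> q /minp; rewrite size_map.
Qed.

Lemma card_le_mu_shadow : (forall x y, connect (shadow e) x y) ->
  #|T| <= mu (shadow e).
Proof.
move=> /shadows_mutually_visible /mu_geP; rewrite cardsE card_codom //.
by move=> x y [].
Qed.

End Shadow.

Arguments base {T} x.

(** * Columns of the shadow of a cycle *)

Section ShadowCycle.
Variable n : nat.
Hypothesis n_ge3 : 3 <= n.

Let n_gt0 : 0 < n. Proof. exact: leq_trans n_ge3. Qed.

Local Notation C := (@cycle_graph n).
Local Notation S := (shadow C).

(** Indexing by all naturals makes every arc of the cycle an interval. *)
Definition col (m : nat) : 'I_n := Ordinal (ltn_pmod m n_gt0).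

Lemma col_ord (i : 'I_n) : col i = i.
Proof. by apply: val_inj; rewrite /= modn_small. Qed.

Lemma colDn m : col (m + n) = col m.
Proof. by apply: val_inj; rewrite /= modnDr. Qed.

Lemma colS m : col m.+1 = ordS (col m).
Proof. by apply: val_inj; rewrite /= -addn1 -modnDml addn1. Qed.

Lemma col_eqD b s t : s < n -> t < n -> (col (b + s) == col (b + t)) = (s == t).
Proof.
by move=> sn tn; rewrite -val_eqE /= eqn_modDl !modn_small.
Qed.

Lemma col_neq a c : a < c < a + n -> col a != col c.
Proof.
move=> ac; have -> : c = a + (c - a) by lia.
by have := @col_eqD a 0 (c - a); rewrite addn0 => ->; lia.
Qed.

Lemma cycle_colS m : C (col m) (col m.+1).
Proof. by rewrite /cycle_graph colS eqxx. Qed.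

Lemma cycle_col_path a d : path C (col a) [seq col m | m <- iota a.+1 d].
Proof. by elim: d a => //= d IHd a; rewrite cycle_colS IHd. Qed.

Lemma shadow_cycle_connect x y : connect S x y.
Proof.
have Cs := @cycle_graph_sym n.
have Ss : connect_sym S by apply/sym_connect_sym/shadow_sym.
have toinl z : connect S z (inl (ordS (base z))).
  by apply: connect1; rewrite shadow_inl_r /cycle_graph eqxx.
have inlD a d : connect S (inl (col a)) (inl (col (a + d))).
  elim: d => [|d IHd]; first by rewrite addn0.
  apply: connect_trans IHd (connect1 _).
  by rewrite addnS /=; apply: cycle_colS.
apply: connect_trans (toinl x) _; rewrite Ss.
apply: connect_trans (toinl y) _; rewrite Ss.
set i := ordS _; set j := ordS _.
(* Going forward [n - i] steps from [i] reaches column 0, and [j] more reach [j]. *)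
have := inlD i (n - i + j); rewrite col_ord addnA subnKC ?(ltnW (ltn_ord i)) //.
by rewrite addnC colDn col_ord.
Qed.

(* Walking without meeting the column [b], the offset from [b] stays in
   [1, n - 1] and moves by one at each step. *)
Lemma barrier b t s (p : seq 'I_n) : 0 < t < n -> 0 < s < n ->
  path C (col (b + t)) p -> last (col (b + t)) p = col (b + s) ->
  col b \notin p -> t <= s + size p.
Proof.
move=> + sn; elim: p t => [|j p IHp] t tn /=.
  by move=> _ /eqP; rewrite col_eqD; lia.
case/andP=> Cj ep lp; rewrite inE negb_or => /andP[jb bp].
have [jE|jE] : j = col (b + t.+1) \/ j = col (b + t.-1).
  case/orP: Cj => /eqP jE; first by left; rewrite addnS colS.
  right; apply: ordS_inj; rewrite jE -colS; congr col; lia.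
(* The new offset stays strictly between 0 and [n], since both extremes denote the avoided column
   [b]. *)
all: rewrite jE in ep lp jb; have := IHp _ _ ep lp bp.
  have [tE|] := eqVneq t.+1 n; last by lia.
  by move: jb; rewrite tE colDn eqxx.
have [tE|] := posnP t.-1; last by lia.
by move: jb; rewrite tE addn0 eqxx.
Qed.

Section Weights.
Variable X : {set 'I_n + 'I_n}.

Definition weight (m : nat) : nat := (inl (col m) \in X) + (inr (col m) \in X).

Lemma card_columns :
  #|X| = \sum_(i < n) (inl i \in X : nat) + \sum_(i < n) (inr i \in X : nat).
Proof.
by rewrite -sum1_card big_mkcond big_sumType /=; congr (_ + _);
  apply: eq_bigr => i _; case: ifP.
Qed.

Lemma card_weight : #|X| = \sum_(i < n) weight i.
Proof.
by rewrite card_columns -big_split; apply: eq_bigr => i _; rewrite /weight col_ord.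
Qed.

Lemma weight_gt0P m : 0 < weight m -> exists2 x, x \in X & base x = col m.
Proof.
rewrite /weight; have [|_] := boolP (inl _ \in X); first by exists (inl (col m)).
by have [|//] := boolP (inr _ \in X); exists (inr (col m)).
Qed.

(** Avoiding column [b] forces the long way round, with at least [n - (c - a)] edges, whereas the
    direct arc has only [c - a]. *)
Lemma full_column_blocks a b c : mutual_visibility_set S X ->
  a < b < c -> 2 * (c - a) < n -> weight b = 2 -> weight a = 0 \/ weight c = 0.
Proof.
move=> visX abc short Wb.
have [->|/weight_gt0P[x xX xa]] := posnP (weight a); first by left.
have [->|/weight_gt0P[y yX yc]] := posnP (weight c); first by right.
exfalso.
have xy : x != y.
  have := @col_neq a c; rewrite -xa -yc => neq.
  by apply: contra_neq (neq _) => [->|]; last by lia.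
case/(visibleP S X xy): (visX x y xX yX xy) => p [ep pX minp].
(* The originals strictly between [a] and [c] bound the length of a shortest walk. *)
pose q : seq ('I_n + 'I_n) := [seq inl (col m) | m <- iota a.+1 (c - a).-1].
have sz_q : size q = (c - a).-1 by rewrite size_map size_iota.
have eq : path S x (rcons q y).
  have -> : q = map (inl \o base) q by rewrite -map_comp; apply: eq_map.
  apply: shadow_lift_path; [exact: cycle_graph_sym | by rewrite sz_q; lia|].
  have := cycle_col_path a (c - a); have -> : c - a = (c - a).-1 + 1 by lia.
  rewrite iotaD map_cat cats1 -map_comp xa yc.
  by congr (path _ _ (rcons _ (col _))); lia.
have := minp _ eq; rewrite sz_q => le_p.
have bp : col b \notin map base (rcons p y).
  apply/mapP => -[z]; rewrite mem_rcons inE => /predU1P[->|zp] zb.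
    by have := @col_neq b c; rewrite zb yc eqxx => /(_ _); lia.
  move: (pX z zp) zb Wb; case: z {zp} => z /= /negPf zX zb; rewrite /weight zb zX.
    by case: (_ \in X).
  by case: (_ \in X).
have := shadow_project_path (@cycle_graph_sym n) ep.
(* Seen from [b], column [a] has offset [n - (b - a)] and column [c] has offset [c - b], as
   [barrier] requires. *)
have -> : base x = col (b + (n - (b - a))).
  by rewrite xa -colDn; congr col; lia.
move=> /(@barrier _ _ (c - b)) H.
have : n - (b - a) <= c - b + size (map base (rcons p y)).
  apply: H => //; [lia|lia|].
  by rewrite map_rcons last_rcons yc; congr col; lia.
rewrite size_map size_rcons; move: le_p; move: (size p) => k; lia.
Qed.

Lemma mutual_visibility_card_le : 7 <= n ->
  mutual_visibility_set S X -> #|X| <= n.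
Proof.
move=> n7 visX; rewrite card_weight; apply: periodic_weight_sum => // [m|m|a b c].
- by rewrite /weight colDn.
- by rewrite /weight; do 2![case: (_ \in X)].
- exact: full_column_blocks.
Qed.

End Weights.

Lemma mu_shadow_cycle_ge : n <= mu S.
Proof.
rewrite -{1}(card_ord n); apply: card_le_mu_shadow; first exact: cycle_graph_sym.
exact: shadow_cycle_connect.
Qed.

Lemma mu_shadow_cycle_large : 7 <= n -> mu S = n.
Proof.
move=> n7; apply/eqP; rewrite eqn_leq mu_shadow_cycle_ge andbT.
by apply: mu_leP => X; apply: mutual_visibility_card_le.
Qed.

End ShadowCycle.

(** * Decision procedures for small cycles *)

(* Vertices coded by natural numbers below [n + n]: [i] for the original [i] and
   [n + i] for its shadow. *)
Section Codes.
Variable n : nat.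

Definition adj (x y : nat) : bool :=
  let i := x %% n in let j := y %% n in
  ((i.+1 %% n == j) || (j.+1 %% n == i)) && ~~ ((n <= x) && (n <= y)).

Definition verts := iota 0 (n + n).

(** [d] counts interior vertices, and only these are tested by [P]. *)
Fixpoint reach (P : pred nat) (d u v : nat) : bool :=
  if d is d'.+1 then
    lazy_has (fun w => if adj u w then if P w then reach P d' w v else false
                   else false) verts
  else adj u v.

(* Distances are at most 3 when [n <= 6], so at most 2 interior vertices. *)
Definition blocked (P : pred nat) (u v : nat) : bool :=
  lazy_has (fun d => if reach predT d u v then
    all (fun d' => ~~ reach P d' u v) (iota 0 d.+1) else false) (iota 0 3).

Definition sees (P : pred nat) (u v : nat) : bool :=
  lazy_has (fun d => if reach P d u v then
    all (fun d' => ~~ reach predT d' u v) (iota 0 d) else false) (iota 0 3).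

Definition mask_blocked (m : seq bool) : bool :=
  lazy_has (fun u => if nth false m u then
    lazy_has (fun v => if nth false m v then if u == v then false else
      blocked (fun x => ~~ nth false m x) u v else false) verts
    else false) verts.

Definition mask_visible (m : seq bool) : bool :=
  all (fun u => all (fun v =>
    [&& nth false m u, nth false m v & u != v] ==>
      sees (fun x => ~~ nth false m x) u v) verts) verts.

Hypothesis n_ge3 : 3 <= n.
Local Notation V := ('I_n + 'I_n)%type.
Local Notation S := (shadow (@cycle_graph n)).

Definition code (x : V) : nat := match x with inl i => i | inr i => n + i end.

Definition decode (m : nat) : V :=
  if m < n then inl (col n_ge3 m) else inr (col n_ge3 m).

Lemma codeK : cancel code decode.
Proof.
case=> i; rewrite /decode /= ?ltn_ord ?col_ord //.
by rewrite ltnNge leq_addr /= addnC colDn col_ord.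
Qed.

Lemma decodeK m : m < n + n -> code (decode m) = m.
Proof.
move=> mn; rewrite /decode; case: ltnP => /= ltm; first by rewrite modn_small.
have -> : m %% n = m - n; last by lia.
by rewrite -[in LHS](subnK ltm) modnDr modn_small //; lia.
Qed.

Lemma code_lt x : code x < n + n.
Proof. by case: x => i /=; have := ltn_ord i; lia. Qed.

Lemma code_verts x : code x \in verts.
Proof. by rewrite mem_iota code_lt. Qed.

Lemma adjE x y : adj (code x) (code y) = S x y.
Proof.
rewrite /adj; case: x y => [i|i] [j|j] /=;
  rewrite ?modnDl ?[i %% n]modn_small ?[j %% n]modn_small ?leq_addr //=.
- by rewrite leqNgt ltn_ord /= andbT.
- by rewrite leqNgt ltn_ord /= andbT orbC.
- by rewrite leqNgt ltn_ord /= andbT.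
- by rewrite andbF.
Qed.

Lemma reachP P d u v :
  reflect (exists p : seq V, [/\ size p = d, path S u (rcons p v) & all (P \o code) p])
          (reach P d (code u) (code v)).
Proof.
elim: d u => [|d IHd] u /=.
  rewrite adjE; apply: (iffP idP) => [uv|[p [/size0nil -> /= /andP[]]]] //.
  by exists [::]; rewrite /= uv.
rewrite lazy_hasE; apply: (iffP hasP) => [[w]|[[|w p] [//= [sp]]]].
  rewrite mem_iota => /andP[_ lew].
  rewrite -(decodeK lew) adjE; case: ifP => // uw; case: ifP => // Pw.
  case/IHd=> p [sp ep Pp]; exists (decode w :: p).
  by rewrite /= sp uw Pw.
case/andP=> uw ep /andP[Pw Pp]; exists (code w); first exact: code_verts.
by rewrite adjE uw [P _]Pw; apply/IHd; exists p.
Qed.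

Lemma reachT d u v (p : seq V) :
  path S u (rcons p v) -> size p = d -> reach predT d (code u) (code v).
Proof. by move=> ep sp; apply/reachP; exists p; rewrite all_predT. Qed.

Section Masks.
Variables (X : {set V}) (P : pred nat).
Hypothesis PX : forall x, P (code x) = (x \notin X).

(** A walk with [d] interior vertices bounds the shortest ones, so visibility would yield a walk
    through [P] with at most [d]. *)
Lemma blockedP u v : u != v ->
  blocked P (code u) (code v) -> ~ visible S X u v.
Proof.
move=> uv; rewrite /blocked lazy_hasE => /hasP[d _].
case: ifP => // /reachP[q [sq eq _]] /allP H /(visibleP _ _ uv)[p [ep pX minp]].
have := H (size p); rewrite mem_iota /= add0n ltnS -{1}sq minp // => /(_ erefl) /negP.
apply; apply/reachP; exists p; split=> //.
by apply/allP => x xp /=; rewrite PX pX.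
Qed.

Lemma seesP u v : u != v -> sees P (code u) (code v) -> visible S X u v.
Proof.
move=> uv; rewrite /sees lazy_hasE => /hasP[d _].
case: ifP => // /reachP[p [sp ep /allP Pp]] /allP H.
apply/visibleP => //; exists p; split=> // [x xp|q eq].
  by rewrite -PX; apply: Pp.
rewrite sp leqNgt; apply/negP => ltq; have := H (size q).
by rewrite mem_iota /= add0n ltq => /(_ erefl); rewrite (reachT eq).
Qed.

End Masks.

Lemma card_mask (X : {set V}) m : size m = n + n ->
  (forall x, nth false m (code x) = (x \in X)) -> #|X| = count id m.
Proof.
move=> sm mX.
have -> : count id m = \sum_(i < n + n) nth false m i.
  by rewrite -sm -sumn_count sumnE big_map (big_nth false) big_mkord.
rewrite big_split_ord card_columns /=.
by congr (_ + _); apply: eq_bigr => i _; rewrite -mX.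
Qed.

Lemma mu_le_masks b :
  all_words [:: true; false] (n + n)
    (fun m => if b < count id m then mask_blocked m else true) ->
  mu S <= b.
Proof.
move=> H; apply: mu_leP => X visX.
pose m := mkseq (fun x => decode x \in X) (n + n).
have sm : size m = n + n by rewrite size_mkseq.
have mX x : nth false m (code x) = (x \in X) by rewrite nth_mkseq ?code_lt // codeK.
have : {subset m <= [:: true; false]} by move=> [] _; rewrite !inE.
move/(all_wordsP H sm); rewrite -(card_mask sm mX).
case: ltnP => // _; rewrite /mask_blocked lazy_hasE => /hasP[u].
rewrite mem_iota => /andP[_ ltu]; rewrite -(decodeK ltu) mX; case: ifP => // uX.
rewrite lazy_hasE => /hasP[v].
rewrite mem_iota => /andP[_ ltv]; rewrite -(decodeK ltv) mX; case: ifP => // vX.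
case: eqVneq => // uv /blockedP H'; exfalso; apply: (H' X) => [x||].
- by rewrite mX.
- by apply: contra_neq uv => ->.
by apply: visX => //; apply: contra_neq uv => ->.
Qed.

Lemma mu_ge_mask m : size m = n + n -> mask_visible m -> count id m <= mu S.
Proof.
move=> sm vis; pose X : {set V} := [set x | nth false m (code x)].
have mX x : nth false m (code x) = (x \in X) by rewrite inE.
rewrite -(card_mask sm mX); apply: mu_geP => u v uX vX uv.
apply: (@seesP X (fun x => ~~ nth false m x)) => // [x|]; first by rewrite mX.
move/allP/(_ _ (code_verts u))/allP/(_ _ (code_verts v)): vis.
by rewrite !mX uX vX (can_eq codeK) uv.
Qed.

End Codes.

(** The upper bound runs through all [2 ^ (n + n)] masks; the lower bound is one explicit mask. *)
Lemma mu_eq_mask n b m (n_ge3 : 3 <= n) :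
  all_words [:: true; false] (n + n)
    (fun m => if b < count id m then mask_blocked n m else true) ->
  [&& size m == n + n, count id m == b & mask_visible n m] ->
  mu (shadow (@cycle_graph n)) = b.
Proof.
move=> ub /and3P[/eqP sm /eqP cm vis]; apply/eqP.
by rewrite eqn_leq mu_le_masks //= -cm mu_ge_mask.
Qed.

(** * Cycles of length 3 to 6, and the conclusion *)

Lemma mu_shadow_C3 : mu (shadow (@cycle_graph 3)) = 4.
Proof.
(* The first row of a mask marks the chosen originals, the second the chosen shadows. *)
by apply: (@mu_eq_mask 3 _
  [:: true; true; false;
      true; true; false]); vm_compute.
Qed.

Lemma mu_shadow_C4 : mu (shadow (@cycle_graph 4)) = 6.
Proof.
by apply: (@mu_eq_mask 4 _
  [:: true; true; false; false;
      true; true; true; true]); vm_compute.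
Qed.

Lemma mu_shadow_C5 : mu (shadow (@cycle_graph 5)) = 6.
Proof.
by apply: (@mu_eq_mask 5 _
  [:: true; false; false; true; false;
      true; true; true; true; false]); vm_compute.
Qed.

Lemma mu_shadow_C6 : mu (shadow (@cycle_graph 6)) = 7.
Proof.
by apply: (@mu_eq_mask 6 _
  [:: true; false; false; false; true; false;
      true; true; true; true; true; false]); vm_compute.
Qed.

Theorem theorem4p7 (n : nat) (hn : 3 <= n) :
  mu (shadow (@cycle_graph n)) =
    if n == 4 then 6 else if n \in [:: 3; 5; 6] then n.+1 else n.
Proof.
have [n7|] := leqP 7 n.
  rewrite mu_shadow_cycle_large // !inE.
  by do 4![case: eqVneq => [nE|_]; first by rewrite nE in n7].
case: n hn => [|[|[|[|[|[|[|n]]]]]]] // _ _.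
- exact: mu_shadow_C3.
- exact: mu_shadow_C4.
- exact: mu_shadow_C5.
- exact: mu_shadow_C6.
Qed.
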